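(* Let $G$ be a group and $G+_{\partial}Y \in EPers(G)$ with action $L+\varphi: G \curvearrowright G+_{\partial}Y$. Let $P \subseteq Y$ be the set of bounded parabolic points of $L+\varphi$ lying in $Y$, $P' \subseteq P$ a set of representatives of orbits, and $\{Stab_{\varphi} p+_{\partial_{p}}C_{p}\}_{p\in P'}$ a family with $Stab_{\varphi} p+_{\partial_{p}}C_{p}\in EPers(Stab_\varphi p)$ and actions $L_p+\eta_{p}$; put $\mathcal C=\{C_p\}_{p\in P'}$ and let $(G+_{\partial}Y)\ltimes \mathcal{C}$ be the corresponding parabolic blowup, regarded as containing $G$ as an open equivariant subspace via the canonical embedding. Then $(G+_{\partial}Y) \ltimes \mathcal{C} \in EPers(G)$.
   Context: Groups are discrete. An action of a group $H$ on a locally compact Hausdorff space $V$ is properly discontinuous if for every compact $K\subseteq V$ the set $\{h\in H: hK\cap K\neq\emptyset\}$ is finite, and cocompact if $HK=V$ for some compact $K\subseteq V$. A point $p$ of a compact Hausdorff space $Z$ on which $G$ acts by homeomorphisms is bounded parabolic if its stabilizer acts properly discontinuously and cocompactly on $Z\setminus\{p\}$. A compact Hausdorff space has a unique compatible uniform structure; for an entourage $u$, a subset $A$ is $u$-small if $A\times A\subseteq u$. Gluing notation: $V+_fC$ denotes a topological space with underlying set $V\sqcup C$ in which $V$ is open and $V$, $C$ carry their given topologies; $f$ records the topology via $f(A)=\overline{A}\cap C$ for $A$ closed in $V$ (so $B$ is closed iff $B\cap V$, $B\cap C$ are closed in $V$, $C$ and $f(B\cap V)\subseteq B$). $EPers(H)$,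 for a discrete group $H$: compact Hausdorff spaces $H+_\partial C$ with an action $L+\eta$ of $H$ by homeomorphisms ($L$ left multiplication on $H$, $\eta$ an action on $C$) such that for every entourage $u$ and every finite $F\subseteq H$, $hF$ is $u$-small for all but finitely many $h\in H$. Given $H+_\partial C\in EPers(H)$ and a properly discontinuous cocompact action of $H$ on a locally compact Hausdorff $V$ with compact $K\subseteq V$ such that $HK=V$, let $V+_{\partial_\Pi}C$ be the gluing given by $\partial_\Pi(S)=\partial(\{h\in H: hK\cap S\neq\emptyset\})$ for $S$ closed in $V$; it is compact Hausdorff and independent of $K$. Parabolic blowup of $Z=G+_\partial Y$ with action $\Phi=L+\varphi$, at the points of $P$: for $p\in P'$ and $q$ in its orbit choose $h_{p,q}\in G$ with $\Phi(h_{p,q},p)=q$, $h_{p,p}=1$; put $C_q=C_p$ and let $Stab_\varphi q+_{\partial_q}C_q$ have the topology making the map $x\mapsto h_{p,q}^{-1}xh_{p,q}$ on $Stab_\varphi q$ together with $\mathrm{id}$ on $C_q=C_p$ a homeomorphism onto $Stab_\varphi p+_{\partial_p}C_p$. Let $X_q=(Z\setminus\{q\})+_{(\partial_q)_\Pi}C_q$ and let $\pi_q:X_q\to Z$ be the identity on $Z\setminus\{q\}$ and send $C_q$ to $q$. Then $Z\ltimes\mathcal C=\{(z,(x_q)_{q\in P}): \pi_q(x_q)=z\ \forall q\}\subseteq Z\times\prod_{q\in P} X_q$. $G$ acts by homeomorphisms, via the action induced by $\Phi$ and the maps $X_q\to X_{\Phi(g,q)}$ equal to $\Phi(g,\cdot)$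 on $Z\setminus\{q\}$ and to $\eta_p(h_{p,\Phi(g,q)}^{-1}gh_{p,q},\cdot)$ on $C_q$. The canonical embedding $G\to Z\ltimes\mathcal C$ is $g\mapsto (g,(g)_{q\in P})$; it is an equivariant open embedding. *)

(* Defs.v *)
From HB Require Import structures.
From mathcomp Require Import all_boot all_classical.
From mathcomp Require Import topology.

Set Implicit Arguments.
Unset Strict Implicit.
Unset Printing Implicit Defensive.

Local Open Scope classical_set_scope.
Local Open Scope group_scope.

Record action (H : groupType) (X : Type) := Action {
  act :> H -> X -> X;
  act1 : forall x, act 1 x = x;
  actM : forall g h x, act (g * h) x = act g (act h x)
}.

Definition act_orbit (H : groupType) (X : Type) (a : action H X) (x : X) : set X :=
  [set a h x | h in [set: H]].

(** [P'] is a set of representatives of the orbits of the points of [P]. *)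
Definition orbit_representatives (H : groupType) (X : Type) (a : action H X)
    (P P' : set X) : Prop :=
  P' `<=` P /\ (forall q, P q -> exists! p, P' p /\ act_orbit a p q).

Section Stabilizer.
Variables (H : groupType) (X : choiceType) (a : action H X) (x : X).

Record stab := Stab { stab_val : H; stab_fix : a stab_val x == x }.

HB.instance Definition _ := [isSub for stab_val].
HB.instance Definition _ := [Choice of stab by <:].

Lemma stab_group_closed : group_closed [pred h | a h x == x].
Proof.
split=> [|g h]; rewrite !inE ?act1// => /eqP gx /eqP hx.
have hVx : a h^-1 x = x by rewrite -[in LHS]hx -actM mulVg act1.
by rewrite actM hVx gx.
Qed.

HB.instance Definition _ :=
  SubChoice_isSubGroup.Build H _ stab stab_group_closed.

End Stabilizer.

Definition punctured (X : topologicalType) (x : X) : Type :=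
  set_type (~` [set x]).
HB.instance Definition _ (X : topologicalType) (x : X) :=
  Topological.on (punctured x).

Lemma punctured_neq (X : topologicalType) (x : X) (v : punctured x) :
  val v <> x.
Proof. exact: (set_valP v). Qed.

Definition to_punctured (X : topologicalType) (x y : X) (yx : y <> x) :
  punctured x := exist _ y (mem_set yx).

Section PuncturedAction.
Variables (H : groupType) (X : topologicalType) (a : action H X).

Lemma act_neq (g : H) (x y v : X) : a g x = y -> v <> x -> a g v <> y.
Proof.
move=> <- vx /(congr1 (a g^-1)); rewrite -!actM mulVg !act1; exact: vx.
Qed.

(** The bijection from [X \ {x}] to [X \ {y}] given by [g], when [g x = y]. *)
Definition act_punctured (g : H) (x y : X) (gx : a g x = y)
    (v : punctured x) : punctured y :=
  to_punctured (act_neq gx (@punctured_neq _ x v)).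

Variable x : X.

Definition stab_fun (g : stab a x) : punctured x -> punctured x :=
  act_punctured (eqP (stab_fix g)).

Lemma stab_fun1 v : stab_fun 1 v = v.
Proof. by apply: val_inj; rewrite /= act1. Qed.

Lemma stab_funM g h v : stab_fun (g * h) v = stab_fun g (stab_fun h v).
Proof. by apply: val_inj; rewrite /= actM. Qed.

Definition stab_action : action (stab a x) (punctured x) :=
  Action stab_fun1 stab_funM.

End PuncturedAction.

Section BoundedParabolic.
Variables (H : groupType) (V : topologicalType) (a : action H V).

Definition properly_discontinuous : Prop :=
  forall K : set V, compact K ->
    finite_set [set h : H | (a h @` K) `&` K !=set0].

Definition cocompact_by (K : set V) : Prop :=
  compact K /\ \bigcup_(h in [set: H]) (a h @` K) = [set: V].

Definition cocompact : Prop := exists K : set V, cocompact_by K.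

End BoundedParabolic.

Definition bounded_parabolic (H : groupType) (Z : topologicalType)
    (a : action H Z) (p : Z) : Prop :=
  properly_discontinuous (stab_action a p) /\ cocompact (stab_action a p).

(** The same axioms as those of the library's [uniformType], for a uniform
    structure inducing the given topology of [X]. *)
Record compatible_uniformity (X : topologicalType)
    (E : set_system (X * X)) : Prop := {
  cu_filter : Filter E;
  cu_diagonal : forall A, E A -> diagonal `<=` A;
  cu_inv : forall A, E A -> E (A^-1)%relation;
  cu_split : forall A, E A ->
    exists2 B, E B & (B \; B)%relation `<=` A;
  cu_nbhs : @nbhs X X = nbhs_ E
}.

(** Entourages of the compatible uniform structure; it exists and is unique
    when [X] is compact Hausdorff, the only case in which this is used. *)
Definition is_entourage (X : topologicalType) (u : set (X * X)) : Prop :=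
  exists E, compatible_uniformity E /\ E u.

Definition small (X : Type) (u : set (X * X)) (A : set X) : Prop :=
  A `*` A `<=` u.

(** The maps [f] from closed sets of [V] to closed sets of [C] for which the
    gluing [V +_f C] is a topological space; values at non-closed sets are junk. *)
Record admissible (V C : topologicalType) := Admissible {
  adm :> set V -> set C;
  adm_closed : forall A, closed A -> closed (adm A);
  adm0 : adm set0 = set0;
  admU : forall A B, closed A -> closed B -> adm (A `|` B) = adm A `|` adm B
}.

Definition gluing (V C : topologicalType) (f : admissible V C) : Type :=
  (V + C)%type.

Section Glue.
Variables (V C : topologicalType) (f : admissible V C).

Definition glue_closed (B : set (gluing f)) : Prop :=
  [/\ closed (inl @^-1` B : set V), closed (inr @^-1` B : set C) &
      f (inl @^-1` B) `<=` inr @^-1` B].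

Definition glue_open (B : set (gluing f)) : Prop := glue_closed (~` B).

Lemma adm_mono (A B : set V) : closed A -> closed B -> A `<=` B ->
  f A `<=` f B.
Proof.
move=> cA cB /setUidPr AB; rewrite -AB admU//; exact: subsetUl.
Qed.

Lemma glue_openT : glue_open setT.
Proof.
rewrite /glue_open setCT; split; rewrite ?preimage_set0 ?adm0//; exact: closed0.
Qed.

Lemma glue_openI : setI_closed glue_open.
Proof.
move=> A B [A1 A2 A3] [B1 B2 B3]; rewrite /glue_open setCI.
split; rewrite !preimage_setU; [exact: closedU|exact: closedU|].
by rewrite admU//; apply: setUSS.
Qed.

Lemma glue_open_bigcup (I : Type) (B : I -> set (gluing f)) :
  (forall i, glue_open (B i)) -> glue_open (\bigcup_i B i).
Proof.
move=> oB; rewrite /glue_open setC_bigcup.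
have cl : closed (inl @^-1` (\bigcap_i ~` B i) : set V).
  by rewrite preimage_bigcap; apply: closed_bigI => i _; case: (oB i).
split => //.
  by rewrite preimage_bigcap; apply: closed_bigI => i _; case: (oB i).
move=> c fc i _; case: (oB i) => cV _; apply.
by apply: adm_mono fc => // v; apply.
Qed.

HB.instance Definition _ := Choice.copy (gluing f) (V + C)%type.
HB.instance Definition _ :=
  isOpenTopological.Build (gluing f) glue_openT glue_openI glue_open_bigcup.

End Glue.

Lemma glue_closedP (V C : topologicalType) (f : admissible V C)
    (B : set (gluing f)) : closed B <-> glue_closed B.
Proof.
rewrite -openC; split=> [|cB]; last by rewrite /open/= /glue_open setCK.
by rewrite /open/= /glue_open setCK.
Qed.

Definition glue_inl (V C : topologicalType) (f : admissible V C) :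
  V -> gluing f := inl.
Definition glue_inr (V C : topologicalType) (f : admissible V C) :
  C -> gluing f := inr.

(** [f] is recovered from the topology of the gluing. *)
Lemma adm_closureE (V C : topologicalType) (f : admissible V C) (A : set V) :
  closed A -> f A = glue_inr f @^-1` closure (glue_inl f @` A).
Proof.
move=> cA; apply/seteqP; split=> c fc.
  move=> /= U; rewrite nbhsE => -[O [oO Oc] OU].
  apply: contrapT => /set0P/negP/negPn/eqP AU.
  case: oO => c1 _ /(_ c); apply=> //; apply: adm_mono fc => // v Av Ov.
  have : (glue_inl f @` A `&` U) (inl v).
    by split; [exists v|exact: OU].
  by rewrite AU.
pose B : set (gluing f) := glue_inl f @` A `|` glue_inr f @` f A.
have BA : inl @^-1` B = A.
  apply/seteqP; split=> [v [[w Aw [<-]]//|[]//]|v Av]; by left; exists v.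
have BC : inr @^-1` B = f A.
  apply/seteqP; split=> [v [[]//|[w Aw [<-]]//]|v Av]; by right; exists v.
have cB : closed B.
  apply/glue_closedP; split; rewrite ?BA ?BC//; exact: adm_closed.
suff : B (glue_inr f c) by case=> [[]//|[w Aw [<-]]].
by apply: cB; move: fc; apply: closure_subset => z; left.
Qed.

Section GlueAction.
Variables (H : groupType) (C : topologicalType).
Variables (f : admissible (discrete_topology H) C) (eta : action H C).

Definition glue_act (h : H) (z : gluing f) : gluing f :=
  match z with
  | inl g => inl (h * g)
  | inr c => inr (eta h c)
  end.

Lemma glue_act1 z : glue_act 1 z = z.
Proof. by case: z => [g|c] /=; [congr inl; exact: mul1g|rewrite act1]. Qed.

Lemma glue_actM g h z : glue_act (g * h) z = glue_act g (glue_act h z).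
Proof.
by case: z => [k|c] /=; [congr inl; exact/esym/mulgA|rewrite actM].
Qed.

(** The action [L + eta]. *)
Definition glue_action : action H (gluing f) := Action glue_act1 glue_actM.

End GlueAction.

(** An object [H +_d C] of [EPers(H)] is given as a space [X] together with the
    inclusion [i] of [H] as an open discrete subspace; [C] is the complement of
    the image of [i], with the subspace topology, and [d A] is the part of the
    closure of [A] lying in [C].  For [X = gluing d], [i] is [glue_inl d]. *)
Record EPers (H : groupType) (X : topologicalType) (i : H -> X)
    (a : action H X) : Prop := {
  ep_compact : compact [set: X];
  ep_hausdorff : hausdorff_space X;
  ep_inj : injective i;
  ep_open : forall A : set H, open (i @` A);
  ep_continuous : forall h, continuous (a h);
  ep_equivariant : forall h g, a h (i g) = i (h * g);
  ep_small : forall (u : set (X * X)) (F : set H),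
    is_entourage u -> finite_set F ->
    finite_set [set h : H | ~ small u (i @` [set h * f | f in F])]
}.

(** The topology of such an [X] is that of the gluing of [H] and [C]. *)
Lemma EPers_closedP (H : groupType) (X : topologicalType) (i : H -> X)
    (a : action H X) (B : set X) : EPers i a ->
  let C := ~` range i in
  closed B <-> (exists2 D, closed D & B `&` C = D `&` C) /\
    closure (B `&` range i) `&` C `<=` B.
Proof.
move=> ep C; split=> [cB|[[D cD BD] sB]].
  split; first by exists B.
  by move=> x [Bx _]; apply: cB; apply: closure_subset Bx => y [].
have cC : closed C by apply: open_closedC; exact: (ep_open ep).
move=> x Bx; have [Cx|/contrapT[h _ hx]] := pselect (C x); last first.
  have ox : open [set x] by rewrite -hx -image_set1; exact: (ep_open ep).
  by have [y [By yx]] := Bx _ (open_nbhs_nbhs (conj ox erefl)); rewrite -yx.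
have : closure ((B `&` range i) `|` (D `&` C)) x.
  apply: closure_subset Bx => y By.
  have [Cy|/contrapT Ry] := pselect (C y); last by left.
  by right; rewrite -BD.
rewrite closureU => -[Bx1|]; first exact: sB.
by move/(closedI cD cC); rewrite -BD => -[].
Qed.

Section Pi.
Variables (H : groupType) (V C : topologicalType).
Variables (d : admissible (discrete_topology H) C) (a : action H V) (K : set V).

Definition hits (S : set V) : set (discrete_topology H) :=
  [set h | (a h @` K) `&` S !=set0].

(** The map [d_Pi] attached to [d]. *)
Definition Pi_fun (S : set V) : set C := d (hits S).

Lemma Pi_closed S : closed S -> closed (Pi_fun S).
Proof. move=> _; apply: adm_closed; exact: discrete_closed. Qed.

Lemma Pi0 : Pi_fun set0 = set0.
Proof.
rewrite -[RHS](adm0 d); congr (adm d _).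
by apply/seteqP; split=> h //= -[v []].
Qed.

Lemma PiU A B : closed A -> closed B -> Pi_fun (A `|` B) = Pi_fun A `|` Pi_fun B.
Proof.
move=> _ _; rewrite /Pi_fun -admU; try exact: discrete_closed.
congr (adm d _); apply/seteqP; split=> h /=.
  by case=> v [Kv [Av|Bv]]; [left|right]; exists v.
by case=> -[v [Kv Sv]]; exists v; split => //; [left|right].
Qed.

Definition Pi : admissible V C := Admissible Pi_closed Pi0 PiU.

End Pi.

(** The stabilizer of [p] in [Y] under [phi], taken in the form of the
    stabilizer of the corresponding point of [Z] under [L + phi]. *)
Notation Stab_at d phi p := (stab (glue_action d phi) (glue_inr d p)).

Section Blowup.
Variables (G : groupType) (Y : topologicalType).
Variables (d : admissible (discrete_topology G) Y) (phi : action G Y).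

Local Notation Z := (gluing d).
Local Notation Phi := (glue_action d phi).

Definition parabolic_points : set Y :=
  [set p | bounded_parabolic Phi (glue_inr d p)].

Variable P' : set Y.

(** The points [q] of the orbits of the points of [P'], each listed with the
    [p] in [P'] whose orbit contains it.  When [P'] is a set of representatives
    of the orbits in [P], this is in bijection with [P] via [q]. *)
Definition orbit_index : Type := {p : P' & act_orbit phi (val p)}.

Lemma orbit_index_bij :
  orbit_representatives phi parabolic_points P' ->
  (forall (p q : Y), parabolic_points p -> act_orbit phi p q ->
    parabolic_points q) ->
  set_bij [set: orbit_index] parabolic_points (fun i => val (projT2 i)).
Proof.
move=> [sP rP] stP; split.
- move=> [p q] _ /=; apply: stP (set_valP q); exact: sP (set_valP p).
- move=> [p q] [p1 q1] _ _ /= qq.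
  have Pq : parabolic_points (val q).
    by apply: stP (set_valP q); exact: sP (set_valP p).
  have [r [_ rU]] := rP _ Pq.
  have pp : p = p1.
    apply: val_inj; rewrite -(rU (val p)); last first.
      by split; [exact: (set_valP p)|exact: (set_valP q)].
    apply: rU; split; first exact: (set_valP p1).
    by have := set_valP q1; rewrite /set_val/= -qq.
  case: p1 / pp q1 qq => q1 qq; congr existT; exact: val_inj.
- move=> q Pq; have [p [[P'p pq] _]] := rP _ Pq.
  pose p1 : P' := exist _ p (mem_set P'p).
  pose q1 : act_orbit phi (val p1) := exist _ q (mem_set pq).
  by exists (existT _ p1 q1).
Qed.

Variable C : P' -> topologicalType.
Variable dC : forall p : P', admissible (discrete_topology (Stab_at d phi (val p))) (C p).
Variable eta : forall p : P', action (Stab_at d phi (val p)) (C p).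

(** The elements [h_{p,q}]. *)
Variable h : forall p : P', act_orbit phi (val p) -> G.
Hypothesis hE : forall (p : P') (q : act_orbit phi (val p)),
  phi (h q) (val p) = val q.

(** Compact subsets of [Z \ {q}] used to form [(d_q)_Pi]. *)
Variable K : forall (p : P') (q : act_orbit phi (val p)),
  set (punctured (glue_inr d (val q))).

Lemma conj_fix (p : P') (q q' : act_orbit phi (val p)) (g : G) :
  Phi g (glue_inr d (val q)) = glue_inr d (val q') ->
  Phi ((h q')^-1 * g * h q) (glue_inr d (val p)) == glue_inr d (val p).
Proof.
move=> [gq]; apply/eqP; congr inr.
by rewrite !actM hE gq -(hE q') -actM mulVg act1.
Qed.

(** [h_{p,q'}^-1 g h_{p,q}], for [g] mapping [q] to [q']. *)
Definition conj_stab (p : P') (q q' : act_orbit phi (val p)) (g : G)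
    (gq : Phi g (glue_inr d (val q)) = glue_inr d (val q')) : Stab_at d phi (val p) :=
  Stab (conj_fix gq).

Section Component.
Variables (p : P') (q : act_orbit phi (val p)).

Definition conj_h (x : Stab_at d phi (val q)) : Stab_at d phi (val p) :=
  conj_stab (eqP (stab_fix x)).

Definition dq_fun (A : set (discrete_topology (Stab_at d phi (val q)))) : set (C p) :=
  dC p (conj_h @` A).

Lemma dq_closed A : closed A -> closed (dq_fun A).
Proof. move=> _; apply: adm_closed; exact: discrete_closed. Qed.

Lemma dq0 : dq_fun set0 = set0.
Proof. by rewrite /dq_fun image_set0 adm0. Qed.

Lemma dqU A B : closed A -> closed B -> dq_fun (A `|` B) = dq_fun A `|` dq_fun B.
Proof.
by move=> _ _; rewrite /dq_fun image_setU admU//; exact: discrete_closed.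
Qed.

(** The gluing map of [Stab q +_{d_q} C_q], where [C_q = C_p]: the topology is
    transported by [glue_conj] below, see [glue_conj_bij] and
    [glue_conj_closed]. *)
Definition dq : admissible (discrete_topology (Stab_at d phi (val q))) (C p) :=
  Admissible dq_closed dq0 dqU.

Definition glue_conj (z : gluing dq) : gluing (dC p) :=
  match z with
  | inl x => inl (conj_h x)
  | inr c => inr c
  end.

Lemma conj_h_inj : injective conj_h.
Proof.
move=> x y /(congr1 val) /= xy; apply: val_inj => /=.
by move/mulIg/mulgI: xy.
Qed.

Lemma conj_h_surj y : exists x, conj_h x = y.
Proof.
have yq : Phi (h q * stab_val y * (h q)^-1) (glue_inr d (val q)) == glue_inr d (val q).
  have hq : Phi (h q) (glue_inr d (val p)) = glue_inr d (val q).
    by congr inr; exact: hE.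
  by rewrite -{1}hq -actM mulgVK actM (eqP (stab_fix y)) hq.
by exists (Stab yq); apply: val_inj => /=; rewrite !mulgA mulVg mul1g mulgVK.
Qed.

Lemma glue_conj_bij : bijective glue_conj.
Proof.
rewrite -setTT_bijective; split=> //.
  move=> [x|c] [y|e] _ _ //= xy; last by case: xy => ->.
  by congr inl; apply: conj_h_inj; exact: inl_inj xy.
move=> [y|c] _; last by exists (inr c).
by have [x <-] := conj_h_surj y; exists (inl x).
Qed.

Lemma glue_conj_closed (B : set (gluing (dC p))) :
  closed (glue_conj @^-1` B) <-> closed B.
Proof.
have E : conj_h @` (inl @^-1` (glue_conj @^-1` B)) = inl @^-1` B.
  apply/seteqP; split=> [_ [x Bx <-]//|y By].
  by have [x xy] := conj_h_surj y; exists x; rewrite //= xy.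
split=> /glue_closedP[_ cB sB]; apply/glue_closedP; split => //;
  try exact: discrete_closed.
- by move: sB; rewrite /= /dq_fun E.
- by rewrite /= /dq_fun E.
Qed.

(** [X_q], and the map [pi_q] collapsing [C_q] to [q]. *)
Definition blowup_at : Type :=
  gluing (Pi dq (stab_action Phi (glue_inr d (val q))) (@K p q)).
HB.instance Definition _ := Topological.on blowup_at.

Definition blowup_proj (x : blowup_at) : Z :=
  match x with
  | inl v => val v
  | inr _ => glue_inr d (val q)
  end.

End Component.

Definition blowup_set :
    set (Z * prod_topology (fun i : orbit_index => blowup_at (projT2 i))) :=
  [set zx | forall i, blowup_proj (zx.2 i) = zx.1].

(** [Z |>< C], as a subspace of the product. *)
Definition blowup : Type := set_type blowup_set.
HB.instance Definition _ := Topological.on blowup.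

(** The map [X_q -> X_{q'}] given by [g], when [g] maps [q] to [q']. *)
Definition blowup_trans (p : P') (q q' : act_orbit phi (val p)) (g : G)
    (gq : Phi g (glue_inr d (val q)) = glue_inr d (val q'))
    (x : blowup_at q) : blowup_at q' :=
  match x with
  | inl v => inl (act_punctured gq v)
  | inr c => inr (eta p (conj_stab gq) c)
  end.

Lemma orbit_act (p : P') (g : G) (q : act_orbit phi (val p)) :
  act_orbit phi (val p) (phi g (val q)).
Proof. by case: (set_valP q) => k _ <-; exists (g * k) => //; rewrite actM. Qed.

Definition orbit_move (p : P') (g : G) (q : act_orbit phi (val p)) :
  act_orbit phi (val p) := exist _ (phi g (val q)) (mem_set (orbit_act g q)).

Lemma orbit_moveK (p : P') (g : G) (q : act_orbit phi (val p)) :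
  Phi g (glue_inr d (val (orbit_move g^-1 q))) = glue_inr d (val q).
Proof. by congr inr; rewrite /= -actM mulgV act1. Qed.

(** The coordinate at [q] of [g x] is the image of the coordinate of [x] at
    [g^-1 q]. *)
Definition blowup_coord (g : G) (x : forall i : orbit_index, blowup_at (projT2 i))
    (i : orbit_index) : blowup_at (projT2 i) :=
  blowup_trans (orbit_moveK g (projT2 i))
    (x (existT _ (projT1 i) (orbit_move g^-1 (projT2 i)))).

Lemma blowup_trans_proj (p : P') (q q' : act_orbit phi (val p)) (g : G)
    (gq : Phi g (glue_inr d (val q)) = glue_inr d (val q')) (x : blowup_at q) :
  blowup_proj (blowup_trans gq x) = Phi g (blowup_proj x).
Proof. by case: x => [v|c]; [|exact/esym]. Qed.

Lemma blowup_act_subproof (g : G) (w : blowup) :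
  blowup_set (Phi g (val w).1, blowup_coord g (val w).2).
Proof.
by move=> i; rewrite /= blowup_trans_proj; congr (Phi g _); exact: (set_valP w).
Qed.

Definition blowup_act (g : G) (w : blowup) : blowup :=
  exist _ (Phi g (val w).1, blowup_coord g (val w).2)
    (mem_set (blowup_act_subproof g w)).

Lemma blowup_trans1 (x : forall i : orbit_index, blowup_at (projT2 i))
    (p : P') (q q' : act_orbit phi (val p))
    (gq : Phi 1 (glue_inr d (val q)) = glue_inr d (val q')) :
  blowup_trans gq (x (existT _ p q)) = x (existT _ p q').
Proof.
have qq' : q = q' by apply: val_inj; case: gq; rewrite act1.
case: q' / qq' gq => gq; case: (x _) => [v|c] /=; congr (_ _).
  by apply: val_inj; rewrite /= glue_act1.
rewrite -[RHS](act1 (eta p)); congr (eta p _ _).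
by apply: val_inj; rewrite /= mulg1 mulVg.
Qed.

Lemma blowup_transM (x : forall i : orbit_index, blowup_at (projT2 i))
    (p : P') (q q1 q2 q' : act_orbit phi (val p)) (g k : G)
    (e : Phi (g * k) (glue_inr d (val q)) = glue_inr d (val q'))
    (e1 : Phi k (glue_inr d (val q1)) = glue_inr d (val q2))
    (e2 : Phi g (glue_inr d (val q2)) = glue_inr d (val q')) :
  blowup_trans e (x (existT _ p q)) =
  blowup_trans e2 (blowup_trans e1 (x (existT _ p q1))).
Proof.
have qq1 : q = q1.
  apply: val_inj; move: e; rewrite actM -e2 -e1 -!actM.
  by move/(congr1 (Phi (g * k)^-1)); rewrite -!actM !mulVg !act1 => -[].
case: q1 / qq1 e1 => e1; case: (x _) => [v|c] /=; congr (_ _).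
  by apply: val_inj; rewrite /= glue_actM.
rewrite -actM; congr (eta p _ _).
by apply: val_inj; rewrite /= !mulgA mulgK.
Qed.

Lemma blowup_act1 w : blowup_act 1 w = w.
Proof.
apply: val_inj => /=; case: (val w) => z x /=; congr (_, _).
  exact: glue_act1.
by apply/functional_extensionality_dep => -[p q]; exact: blowup_trans1.
Qed.

Lemma blowup_actM g k w : blowup_act (g * k) w = blowup_act g (blowup_act k w).
Proof.
apply: val_inj => /=; case: (val w) => z x /=; congr (_, _).
  exact: glue_actM.
by apply/functional_extensionality_dep => -[p q]; exact: blowup_transM.
Qed.

Definition blowup_action : action G blowup := Action blowup_act1 blowup_actM.

Lemma inl_neq (g : G) (q : Y) : glue_inl d g <> glue_inr d q.
Proof. by []. Qed.

Definition blowup_pt (g : G) (i : orbit_index) : blowup_at (projT2 i) :=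
  inl (to_punctured (@inl_neq g (val (projT2 i)))).

Lemma blowup_emb_subproof (g : G) : blowup_set (glue_inl d g, blowup_pt g).
Proof. by []. Qed.

Definition blowup_emb (g : G) : blowup :=
  exist _ (glue_inl d g, blowup_pt g) (mem_set (blowup_emb_subproof g)).

End Blowup.

(* Main.v *)
(** For each parabolic point [q] the smallness condition on [Stab q +_d C_q]
    says that right translations extend by the identity of [C_q].  This makes
    [(Z \ {q}) + C_q] a compact Hausdorff space, and the blowup is a closed
    subspace of a product of such spaces.  Its smallness condition amounts to:
    along an ultrafilter of [g] in [G] leaving every finite set, [g f] and
    [g f'] have the same limit.  They have the same limit in [Z].  If this
    limit is [q], write [g = s k] with [s] in [Stab q] and [k] in the compact
    [K]; then [k f] stays in a compact subset of [Z \ {q}] for every [f], so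
    [g f = s (k f)] has in [X_q] the limit that [s] has in [Stab q +_d C_q],
    which does not depend on [f]. *)
Require Import Defs.
From mathcomp Require Import all_boot all_classical.
From mathcomp Require Import reals topology urysohn Rstruct.

Set Implicit Arguments.
Unset Strict Implicit.
Unset Printing Implicit Defensive.

Local Open Scope classical_set_scope.
Local Open Scope group_scope.

(** * Uniformities, ultrafilters and separation in terms of closed sets *)

(** Normality gives complete regularity by Urysohn's lemma, hence a uniformity. Without one,
    [is_entourage] would hold of nothing and [ep_small] would be vacuous. *)
Lemma compact_hausdorff_uniformizable (X : topologicalType) :
  compact [set: X] -> hausdorff_space X -> exists E, @compatible_uniformity X E.
Proof.
move=> cX hX.
have crX : completely_regular_space X := @normal_completely_regular
  Rdefinitions.R X (compact_normal hX cX) (hausdorff_accessible hX).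
pose T : uniformType :=
  @completely_regular_uniformity.type Rdefinitions.R X crX.
exists (@entourage T); split.
- exact: (@entourage_filter T).
- exact: (@entourage_diagonal_subproof T).
- exact: (@entourage_inv T).
- exact: (@entourage_split_ex T).
- exact: esym (@nbhs_entourageE T).
Qed.

(** Gluings are defined through their closed sets, so convergence is tested on these. *)
Lemma cvg_closedP (X : topologicalType) (F : set_system X) (x : X) : Filter F ->
  F --> x <-> forall B, closed B -> ~ B x -> F (~` B).
Proof.
move=> FF; split=> [Fx B cB Bx|Fx A].
  by apply: Fx; apply: open_nbhs_nbhs; split=> //; exact: closed_openC.
rewrite /= nbhsE => -[O [oO Ox]] /filterS; apply.
by rewrite -[O]setCK; apply: Fx; [exact: open_closedC|exact].
Qed.

Lemma ultra_fmap (T U : Type) (f : T -> U) (F : set_system T) :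
  UltraFilter F -> UltraFilter (f @ F).
Proof.
move=> FU; split=> [|G PG FG]; first exact: fmap_proper_filter.
apply/seteqP; split=> // A GA; have [//|FA] := in_ultra_setVsetC (f @^-1` A) FU.
have GnA : G (~` A) by exact: FG.
by have [u []] := filter_ex (filterI GA GnA).
Qed.

Lemma compact_ultra_cvg (T : Type) (X : topologicalType) (A : set X)
    (f : T -> X) (F : set_system T) :
  compact A -> UltraFilter F -> (\forall t \near F, A (f t)) ->
  exists2 x, A x & f @ F --> x.
Proof.
rewrite compact_ultra => cA FU FA.
by have [x [Ax fx]] := cA _ (ultra_fmap f FU) FA; exists x.
Qed.

Lemma hausdorff_closed_cover (X : topologicalType) :
  hausdorff_space X <-> forall x y : X, x <> y ->
    exists A B, [/\ closed A, closed B, ~ A x, ~ B y & A `|` B = setT].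
Proof.
rewrite open_hausdorff; split=> [hX x y /eqP/hX[[A B]]/=|hX x y /eqP/hX].
  rewrite !inE => -[Ax By] [oA oB AB].
  exists (~` A), (~` B); split; try exact: open_closedC; try by apply.
  by rewrite -setCI AB setC0.
move=> [A [B [cA cB Ax By AB]]]; exists (~` A, ~` B) => /=; rewrite !inE//.
by split; [exact: closed_openC|exact: closed_openC|rewrite -setCU AB setCT].
Qed.

Lemma continuous_inj_hausdorff (X Y : topologicalType) (f : X -> Y) :
  injective f -> continuous f -> hausdorff_space Y -> hausdorff_space X.
Proof.
move=> fI /continuous_closedP cf hY; apply/hausdorff_closed_cover => x y xy.
have fxy : f x <> f y by move/fI.
have [A [B [cA cB Ax By AB]]] := (hausdorff_closed_cover _).1 hY _ _ fxy.
exists (f @^-1` A), (f @^-1` B); split; rewrite ?AB//; try exact: cf.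
by rewrite -preimage_setU AB.
Qed.

Section Homeomorphism.
Variables (X Y : topologicalType) (f : X -> Y).
Hypothesis fbij : bijective f.
Hypothesis fcl : forall B, closed (f @^-1` B) <-> closed B.

Lemma closed_bij_hausdorff : hausdorff_space Y -> hausdorff_space X.
Proof.
apply: (continuous_inj_hausdorff (bij_inj fbij)).
by apply/continuous_closedP => A cA; exact/fcl.
Qed.

Lemma closed_bij_compact : compact [set: Y] -> compact [set: X].
Proof.
case: fbij => g fK gK cY.
have -> : [set: X] = g @` [set: Y].
  by apply/esym/seteqP; split=> // x _; exists (f x) => //; rewrite fK.
apply: continuous_compact => //; apply: continuous_subspaceT.
apply/continuous_closedP => A cA; apply/fcl.
by rewrite -comp_preimage (_ : g \o f = id) //; exact/funext.
Qed.

End Homeomorphism.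

(** * Right translations and the boundary of a group *)

Section Perspective.
Variables (H : groupType) (C : topologicalType).
Variable d : admissible (discrete_topology H) C.

(** Equivalently: right translation by [f], extended by the identity of [C],
    is continuous on [gluing d]. *)
Definition perspective : Prop :=
  forall (f : H) (A : set H), d [set a | A (a * f)] `<=` d A.

Lemma adm_sub (A B : set (discrete_topology H)) : A `<=` B -> d A `<=` d B.
Proof. by move=> AB c; apply: adm_mono AB _; exact: discrete_closed. Qed.

Lemma adm_setU (A B : set (discrete_topology H)) :
  d (A `|` B) = d A `|` d B.
Proof. by rewrite admU//; exact: discrete_closed. Qed.

(** A finite set is closed in a Hausdorff space, so its closure does not reach [C]. *)
Lemma adm_finite (A : set H) :
  hausdorff_space (gluing d) -> finite_set A -> d A = set0.
Proof.
move=> hW fA; rewrite adm_closureE; last exact: discrete_closed.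
apply/seteqP; split=> // c.
have /closure_id <- : closed (glue_inl d @` A).
  have := hausdorff_accessible hW.
  by move/accessible_finite_set_closed; apply; exact: finite_image.
by move=> [].
Qed.

(** Induction on [F], splitting [A] by whether right translation by [f] leads into [B]. In this form
    the condition absorbs the finite sets supplied by proper discontinuity. *)
Lemma perspective_finite (F A B : set H) : perspective -> finite_set F ->
  (forall a, A a -> exists2 f, F f & B (a * f)) -> d A `<=` d B.
Proof.
move=> pd /finite_seqP[s ->]; elim: s A => [|f s IHs] A AB.
  have -> : A = set0 by apply/seteqP; split=> // a /AB[].
  by rewrite adm0.
pose D := [set a | B (a * f)].
have -> : A = (A `&` D) `|` (A `\` D) by rewrite -setIUr setUv setIT.
rewrite adm_setU => c [|].
  by move=> dA; apply: (pd f); apply: adm_sub dA => a [].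
apply: IHs => a [/AB[g]]; rewrite /= inE => /predU1P[->//|gs] Bg _.
by exists g.
Qed.

End Perspective.

(** Take [h] close to [c] with [h * f] in [A]. All but finitely many [h] are close to [h * f], so
    [c] is also a limit of points of [A]. *)
Lemma EPers_perspective (H : groupType) (C : topologicalType)
    (d : admissible (discrete_topology H) C) (a : action H (gluing d)) :
  EPers (glue_inl d) a -> perspective d.
Proof.
move=> ep f A c dAf; apply: contrapT => dAc.
pose B : set (gluing d) := fun z =>
  match z with inl g => A g | inr e => d A e end.
have cB : closed B.
  apply/glue_closedP; split=> //; first exact: discrete_closed.
  by apply: adm_closed; exact: discrete_closed.
have [E cE] :=
  compact_hausdorff_uniformizable (ep_compact ep) (ep_hausdorff ep).
have : nbhs (glue_inr d c) (~` B).
  by apply: open_nbhs_nbhs; split=> //; exact: closed_openC.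
rewrite (cu_nbhs cE) => -[u Eu uB]; have [v Ev vu] := cu_split cE Eu.
have := @ep_small _ _ _ _ ep v [set 1; f] (ex_intro _ E (conj cE Ev))
  (finite_set2 _ _).
set bad := [set h | _] => fbad.
(* The finite set [bad] has empty boundary, so [c] remains a limit point after its removal. *)
have : d (bad `|` ([set h | A (h * f)] `\` bad)) c.
  by apply: adm_sub dAf => h Ah; have [|] := pselect (bad h); [left|right].
rewrite adm_setU adm_finite ?set0U//; last exact: ep_hausdorff ep.
rewrite adm_closureE; last exact: discrete_closed.
have : nbhs (glue_inr d c) (xsection v (glue_inr d c)).
  by rewrite (cu_nbhs cE); exists v.
move=> nv /(_ _ nv)[_ [[h [/= Ahf nbad] <-]] /xsectionP vch].
have sm : small v (glue_inl d @` [set h * g | g in [set 1; f]]).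
  exact: contrapT.
suff /uB : xsection u (glue_inr d c) (glue_inl d (h * f)) by apply.
apply/xsectionP; apply: vu; exists (glue_inl d h) => //.
apply: sm; split => /=.
  by exists h => //; exists 1; [left|rewrite mulg1].
by exists (h * f) => //; exists f; [right|].
Qed.

Lemma perspective_cvg (H : groupType) (C : topologicalType)
    (d : admissible (discrete_topology H) C) (T : Type) (F : set_system T)
    (s : T -> H) (f : H) (c : C) : Filter F -> perspective d ->
  glue_inl d \o s @ F --> glue_inr d c ->
  glue_inl d \o (fun t => s t * f) @ F --> glue_inr d c.
Proof.
move=> FF pd /cvg_closedP sc; apply/cvg_closedP => B cB Bc.
have [_ cBC sB] := (glue_closedP _).1 cB.
(* This is the preimage of [B] under right translation by [f] extended by the identity of [C]. *)
pose D : set (gluing d) := fun w => match w with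
  | inl h => B (glue_inl d (h * f)) | inr e => B (glue_inr d e) end.
have cD : closed D.
  apply/glue_closedP; split=> //; first exact: discrete_closed.
  by move=> e /(pd f (fun h => B (glue_inl d h))); exact: sB.
exact: (sc _ cD Bc).
Qed.

Lemma glue_inl_cvg (H : groupType) (C : topologicalType)
    (d : admissible (discrete_topology H) C) (T : Type) (F : set_system T)
    (s : T -> H) (g : H) : Filter F ->
  glue_inl d \o s @ F --> glue_inl d g <-> \forall t \near F, s t = g.
Proof.
move=> FF; split=> [sg|sg].
  have og : open [set glue_inl d g].
    rewrite -closedC; apply/glue_closedP; split; first exact: discrete_closed.
      rewrite (_ : inr @^-1` _ = setT); first exact: closedT.
      by apply/seteqP; split.
    by move=> e _.
  have /sg Fg : nbhs (glue_inl d g) [set glue_inl d g] by exact: open_nbhs_nbhs.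
  apply: (@filterS _ F _ ((glue_inl d \o s) @^-1` [set glue_inl d g])) Fg.
  by move=> t [].
move=> A /nbhs_singleton Ag; apply: filterS sg => t /= tg.
by rewrite /= tg.
Qed.

(** Any ultrafilter refining the filter of sets that contain all but finitely many points of [S]
    works. *)
Lemma infinite_ultra (T : Type) (S : set T) : infinite_set S ->
  exists F, [/\ UltraFilter F, F S & forall t, F (~` [set t])].
Proof.
move=> iS; pose F : set_system T := [set A | finite_set (S `\` A)].
have PF : ProperFilter F.
  split; first by rewrite /F /= setD0.
  split=> [|A B FA FB|A B AB].
  - by rewrite /F /= setDT; exact: finite_set0.
  - by rewrite /F /= setDIr finite_setU.
  - by apply: sub_finite_set; exact: setDS.
have [U [UU FU]] := ultraFilterLemma PF.
exists U; split=> //.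
  by apply: FU; rewrite /F /= setDv; exact: finite_set0.
move=> t; apply: FU; apply: sub_finite_set (finite_set1 t) => s [_].
exact: contrapT.
Qed.

(** * Compactness and separation of the gluing along [Pi d a K] *)

Section PiGluing.
Variables (H : groupType) (V C : topologicalType).
Variables (d : admissible (discrete_topology H) C) (a : action H V) (K : set V).
Hypotheses (cW : compact [set: gluing d]) (hW : hausdorff_space (gluing d)).
Hypothesis pd : perspective d.
Hypotheses (hV : hausdorff_space V).
Hypothesis lV : forall v : V, exists2 N, nbhs v N & compact N.
Hypothesis ac : forall h, continuous (a h).
Hypotheses (pdV : properly_discontinuous a) (KV : cocompact_by a K).

Local Notation X := (gluing (Pi d a K)).

Lemma properly_discontinuous2 (N N' : set V) : compact N -> compact N' ->
  finite_set [set h | (a h @` N) `&` N' !=set0].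
Proof.
move=> cN cN'; apply: sub_finite_set (pdV (compactU cN cN')) => h.
by case=> _ [[v Nv <-] N'v]; exists (a h v); split; [exists v; [left|]|right].
Qed.

Lemma cocompact_cover (v : V) : exists h, (a h @` K) v.
Proof.
by have [_ /seteqP[_ /(_ v I)[h _ Kv]]] := KV; exists h.
Qed.

(** Hence the topology of [X] does not depend on the choice of [K]. *)
Lemma hits_compact (N S : set V) : compact N ->
  d (hits a N S) `<=` d (hits a K S).
Proof.
move=> cN.
apply: (perspective_finite (F := [set t | (a t @` K) `&` N !=set0])) => //.
  by apply: properly_discontinuous2 => //; case: KV.
move=> h [_ [[v Nv <-] Sv]]; have [t [k Kk kv]] := cocompact_cover v.
exists t; first by exists v; split=> //; exists k.
by exists (a h v); split=> //; exists k => //; rewrite actM kv.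
Qed.

(** Only finitely many translates of [K] meet [N], so [N] has no limit points in [C]. *)
Lemma compact_glue_closed (N : set V) :
  compact N -> closed (glue_inl (Pi d a K) @` N).
Proof.
move=> cN; have NE : inl @^-1` (glue_inl (Pi d a K) @` N) = N.
  by apply/seteqP; split=> [v [w Nw [<-]]|v Nv]//; exists v.
have CE : inr @^-1` (glue_inl (Pi d a K) @` N) = set0.
  by apply/seteqP; split=> [v []|].
apply/glue_closedP; split; rewrite ?NE ?CE.
- exact: compact_closed.
- exact: closed0.
- rewrite /= /Pi_fun adm_finite//.
  by apply: properly_discontinuous2 => //; case: KV.
Qed.

(** A compact neighbourhood of a point meets only finitely many translates, so near that point the
    union is finite. *)
Lemma locally_finite_translates (D : set H) :
  closed (\bigcup_(h in D) (a h @` K)).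
Proof.
have [cK _] := KV; move=> v vD; have [N Nv cN] := lV v.
pose F := [set h | (a h @` K) `&` N !=set0].
have fF : finite_set F by exact: properly_discontinuous2.
have : closed (\bigcup_(h in D `&` F) (a h @` K)).
  apply: closed_bigcup; first exact: finite_setIr.
  move=> h _; apply: compact_closed => //; apply: continuous_compact => //.
  by apply: continuous_subspaceT; exact: ac.
move=> /(_ v)[]; first last.
  by move=> h [Dh _] hv; exists h.
move=> O Ov; have [w [[h Dh hw] [Ow Nw]]] := vD _ (filterI Ov Nv).
by exists w; split=> //; exists h => //; split=> //; exists w.
Qed.

(** Transports closed covers from [gluing d] to [X], and with them the separation of points of
    [C]. *)
Definition saturate (D : set (gluing d)) : set X := fun x =>
  match x with
  | inl v => exists2 h : H, D (glue_inl d h) & (a h @` K) v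
  | inr c => D (glue_inr d c)
  end.

(** If the translates of [K] by [h] and [g] meet, then [h^-1 * g] lies in the finite set of [t]
    whose translate of [K] meets [K]; hence [perspective_finite] applies. *)
Lemma saturate_closed D : closed D -> closed (saturate D).
Proof.
move=> cD; have /glue_closedP[_ cDC sD] := cD.
apply/glue_closedP; split=> //.
  exact: (@locally_finite_translates [set h | D (glue_inl d h)]).
apply: subset_trans sD; have [cK _] := KV.
apply: (perspective_finite (F := [set t | (a t @` K) `&` K !=set0])) => //.
  exact: properly_discontinuous2.
move=> h [_ [[k Kk <-] [g Dg [l Kl lk]]]].
exists (h^-1 * g); last by rewrite /= mulVKg.
by exists k; split=> //; exists l => //; rewrite actM lk -actM mulVg act1.
Qed.

(** A compact neighbourhood of [v] is closed in [X], and its interior is open there. *)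
Lemma Pi_separate_inl_inr (v : V) (c : C) : exists A B : set X,
  [/\ closed A, closed B, ~ A (inl v), ~ B (inr c) & A `|` B = setT].
Proof.
have [N Nv cN] := lV v.
exists (~` (glue_inl (Pi d a K) @` N°)), (glue_inl (Pi d a K) @` N).
split.
- apply: open_closedC; rewrite -closedC; apply/glue_closedP; split.
  + rewrite (_ : inl @^-1` _ = ~` N°); first exact/open_closedC/open_interior.
    apply/seteqP; split=> w /=; apply: contra_not; first by exists w.
    by case=> u Nu [<-].
  + rewrite (_ : inr @^-1` _ = setT); first exact: closedT.
    by apply/seteqP; split=> // e _ [].
  + by move=> e _ [].
- exact: compact_glue_closed.
- by apply; exists v.
- by case.
- apply/seteqP; split=> // x _.
  have [[w Nw <-]|] := pselect ((glue_inl (Pi d a K) @` N°) x); last by left.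
  by right; exists w => //; exact: interior_subset.
Qed.

Lemma Pi_hausdorff : hausdorff_space X.
Proof.
apply/hausdorff_closed_cover => -[v|c] [w|e] xy.
- have vw : v <> w by move=> vw; apply: xy; rewrite vw.
  have [A [B [cA cB Av Bw AB]]] := (hausdorff_closed_cover _).1 hV _ _ vw.
  (* Adding all of [C] makes a closed subset of [V] closed in [X]. *)
  exists (inl @` A `|` range inr), (inl @` B `|` range inr).
  have lE (S : set V) : inl @^-1` (inl @` S `|` range inr : set X) = S.
    by apply/seteqP; split=> [u [[t St [<-]]|[]]//|u Su]; left; exists u.
  have rE (S : set V) : inr @^-1` (inl @` S `|` range inr : set X) = setT.
    by apply/seteqP; split=> // u _; right; exists u.
  split.
  - by apply/glue_closedP; split; rewrite ?lE ?rE.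
  - by apply/glue_closedP; split; rewrite ?lE ?rE.
  - by case=> [[u Au [uv]]|[]//]; apply: Av; rewrite -uv.
  - by case=> [[u Bu [uv]]|[]//]; apply: Bw; rewrite -uv.
  - apply/seteqP; split=> // -[u _|u _]; last by left; right; exists u.
    have : (A `|` B) u by rewrite AB.
    by case=> ?; [left|right]; left; exists u.
- exact: Pi_separate_inl_inr.
- have [A [B [cA cB Ax By AB]]] := Pi_separate_inl_inr w c.
  by exists B, A; split=> //; rewrite setUC.
- have ce : glue_inr d c <> glue_inr d e by case=> ce; apply: xy; rewrite ce.
  have [A [B [cA cB Ac Be AB]]] := (hausdorff_closed_cover _).1 hW _ _ ce.
  exists (saturate A), (saturate B); split=> //; try exact: saturate_closed.
  apply/seteqP; split=> // -[v|u] _.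
    have [h hv] := cocompact_cover v.
    have : (A `|` B) (glue_inl d h) by rewrite AB.
    by case=> ?; [left|right]; exists h.
  have : (A `|` B) (glue_inr d u) by rewrite AB.
  by case=> ?; [left|right].
Qed.

(** Goes opposite to [saturate]: it pulls a closed set of [X] back to [gluing d], where limits are
    known. *)
Definition hits_closure (N : set V) (B : set X) : set (gluing d) := fun w =>
  match w with
  | inl h => hits a N (inl @^-1` B) h
  | inr c => B (glue_inr (Pi d a K) c)
  end.

Lemma hits_closure_closed (N : set V) (B : set X) :
  compact N -> closed B -> closed (hits_closure N B).
Proof.
move=> cN /glue_closedP[_ cB sB]; apply/glue_closedP; split=> //.
  exact: discrete_closed.
exact: subset_trans (hits_compact cN) sB.
Qed.

(** If a closed [B] misses [c], so does the closed set [hits_closure N B]; hence eventually the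
    translate of [N] by [s t] misses [B]. That [N] is an arbitrary compact set is what later lets
    different right translates share a limit. *)
Lemma Pi_cvg_inr (T : Type) (F : set_system T) (s : T -> H) (v : T -> V)
    (N : set V) (c : C) : Filter F -> compact N ->
  (\forall t \near F, (a (s t) @` N) (v t)) ->
  glue_inl d \o s @ F --> glue_inr d c ->
  glue_inl (Pi d a K) \o v @ F --> glue_inr (Pi d a K) c.
Proof.
move=> FF cN vN /cvg_closedP sc; apply/cvg_closedP => B cB Bc.
have := sc _ (hits_closure_closed cN cB) Bc.
apply: filterS2 vN => t sv nB /= Bv.
by apply: nB; exists (v t).
Qed.

(** Each point of [V] is replaced by some group element whose translate of [K] contains it, and a
    limit is first taken in [gluing d]. *)
Lemma Pi_compact : compact [set: X].
Proof.
have [cK _] := KV.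
have [s sK] := choice cocompact_cover.
pose t (x : X) : gluing d :=
  match x with inl v => inl (s v) | inr c => inr c end.
rewrite compact_ultra => F FU _.
have [[h|c] _ tw] := compact_ultra_cvg (f := t) cW FU filterT.
  (* If the limit is a group element [h], the ultrafilter contains a single compact translate of
     [K]. *)
  have cX : compact (glue_inl (Pi d a K) @` (a h @` K)).
    apply: continuous_compact; last first.
      by apply: continuous_compact => //; exact/continuous_subspaceT/ac.
    apply: continuous_subspaceT; apply/continuous_closedP => B.
    by move=> /glue_closedP[].
  have FX : F (glue_inl (Pi d a K) @` (a h @` K)).
    have oh : open [set glue_inl d h].
      rewrite -closedC; apply/glue_closedP; split; first exact: discrete_closed.
        rewrite (_ : inr @^-1` _ = setT); first exact: closedT.
        by apply/seteqP; split.
      by move=> e _.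
    have /tw Ft : nbhs (glue_inl d h) [set glue_inl d h].
      exact: open_nbhs_nbhs.
    apply: (@filterS _ F _ (t @^-1` [set glue_inl d h])) Ft => -[v|c]//= [<-].
    by exists v; first exact: sK.
  by have [x _ Fx] := compact_ultra_cvg (f := id) cX FU FX; exists x.
exists (glue_inr (Pi d a K) c); split=> //; apply/cvg_closedP => B cB Bc.
move/cvg_closedP: tw => /(_ _ (hits_closure_closed cK cB) Bc) Ft.
apply: (@filterS _ F _ (t @^-1` (~` hits_closure K B))) Ft => -[v|e]//= nB Bv.
apply: nB.
by exists v; split=> //; exact: sK.
Qed.

End PiGluing.

(** * Subspaces and punctured spaces *)

Section SetType.
Variables (X : topologicalType) (A : set X).

Lemma continuous_val : continuous (val : set_type A -> X).
Proof. exact: initial_continuous. Qed.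

Lemma continuous_to_set_type (T : topologicalType) (f : T -> set_type A) :
  continuous (val \o f) -> continuous f.
Proof. by move=> cf; exact: (@continuous_comp_initial _ _ _ val f cf). Qed.

Lemma compact_set_type (N : set (set_type A)) :
  compact (val @` N) -> compact N.
Proof.
move=> cN; rewrite compact_ultra => F FU FN.
have FvN : \forall t \near F, (val @` N) (val t).
  by apply: filterS FN => t Nt; exists t.
have [_ [x Nx <-] Fx] := compact_ultra_cvg cN FU FvN.
exists x; split=> // U [_ [[O oO <-] Ox OU]].
by apply: (filterS OU); apply: Fx; exact: open_nbhs_nbhs.
Qed.

Lemma closed_set_type_compact :
  compact [set: X] -> closed A -> compact [set: set_type A].
Proof.
move=> cX cA; apply: compact_set_type.
rewrite (_ : _ @` _ = A); first exact: (subclosed_compact cA cX).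
apply/seteqP; split=> [_ [x _ <-]|x Ax]; first exact: set_valP.
by exists (exist _ x (mem_set Ax)).
Qed.

End SetType.

Lemma punctured_hausdorff (X : topologicalType) (x : X) :
  hausdorff_space X -> hausdorff_space (punctured x).
Proof.
exact: (@continuous_inj_hausdorff (punctured x) X val val_inj
  (@continuous_val X _)).
Qed.

(** Regularity gives a neighbourhood of [v] whose closure misses [x]. *)
Lemma punctured_locally_compact (X : topologicalType) (x : X) :
  compact [set: X] -> hausdorff_space X ->
  forall v : punctured x, exists2 N, nbhs v N & compact N.
Proof.
move=> cX hX v.
have vx : nbhs (val v) (~` [set x]).
  apply: open_nbhs_nbhs; split; last exact: (set_valP v).
  apply: closed_openC; apply: accessible_closed_set1.
  exact: hausdorff_accessible.
have [M Mv Mx] := compact_regular hX cX (filterT : nbhs (val v) setT) vx.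
exists (val @^-1` closure M).
  by apply: (@continuous_val _ _ v); apply: filterS Mv; exact: subset_closure.
apply: compact_set_type; rewrite (_ : _ @` _ = closure M).
  exact: (subclosed_compact (@closed_closure _ M) cX).
apply/seteqP; split=> [_ [y My <-]//|y My].
by exists (to_punctured (Mx _ My)).
Qed.

Lemma act_punctured_continuous (H : groupType) (X : topologicalType)
    (a : action H X) (g : H) (x y : X) (gx : a g x = y) :
  continuous (a g) -> continuous (act_punctured gx).
Proof.
move=> cg; apply: continuous_to_set_type => v.
have := @continuous_comp (punctured x) X X val (a g) v.
by apply; [exact: (@continuous_val X _ v)|exact: cg].
Qed.

(** Conjugation by [g] maps the stabilizer of [y] injectively into that of [x]. This passes from the
    points of [P'] to the rest of their orbits. *)
Lemma properly_discontinuous_stab (H : groupType) (X : topologicalType)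
    (a : action H X) (g : H) (x y : X) : (forall h, continuous (a h)) ->
  a g x = y -> properly_discontinuous (stab_action a x) ->
  properly_discontinuous (stab_action a y).
Proof.
move=> ca gx pdx L cL.
have gy : a g^-1 y = x by rewrite -gx -actM mulVg act1.
have cL' : compact (act_punctured gy @` L).
  apply: continuous_compact => //.
  exact/continuous_subspaceT/act_punctured_continuous.
have conjx (s : stab a y) : a (g^-1 * stab_val s * g) x == x.
  by rewrite !actM gx (eqP (stab_fix s)) gy.
pose c s := Stab (conjx s).
have c_inj : injective c.
  by move=> s t /(congr1 (@stab_val _ _ _ _))/= /mulIg/mulgI st; exact: val_inj.
rewrite -(eq_finite_set (inj_card_eq (in2W c_inj))).
apply: sub_finite_set (pdx _ cL') => _ [s [_ [[v Lv <-] Lsv]] <-] /=.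
exists (act_punctured gy (stab_action a y s v)); split; last first.
  by exists (stab_action a y s v).
exists (act_punctured gy v); first by exists v.
by apply: val_inj; rewrite /= -!actM mulgK.
Qed.

Lemma continuous_funcomp (X Y Z : topologicalType) (f : X -> Y) (g : Y -> Z) :
  continuous f -> continuous g -> continuous (g \o f).
Proof. by move=> cf cg x; apply: continuous_comp; [exact: cf|exact: cg]. Qed.

Lemma continuous_fst (T U : topologicalType) : continuous (@fst T U).
Proof. by move=> x; exact: cvg_fst. Qed.

Lemma continuous_snd (T U : topologicalType) : continuous (@snd T U).
Proof. by move=> x; exact: cvg_snd. Qed.

(** * Fiber products over a Hausdorff base *)

Section FiberProduct.
Variables (Z : topologicalType) (I : Type) (X : I -> topologicalType).
Variable pi : forall i, X i -> Z.

Definition fiber_product_set : set (Z * prod_topology X) :=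
  [set zx | forall i, pi (zx.2 i) = zx.1].

Local Notation fiber_product := (set_type fiber_product_set).

Lemma continuous_proj (i : I) : continuous (fun x : prod_topology X => x i).
Proof. exact: (@proj_continuous {classic I} X i). Qed.

Lemma continuous_snd_proj (i : I) :
  continuous (fun zx : Z * prod_topology X => zx.2 i).
Proof.
exact: (continuous_funcomp (@continuous_snd Z _) (@continuous_proj i)).
Qed.

Lemma fiber_product_base_continuous :
  continuous (fun w : fiber_product => (val w).1).
Proof. 
exact: (continuous_funcomp (@continuous_val _ fiber_product_set)
  (@continuous_fst _ _)).
Qed.

Lemma fiber_product_coord_continuous (i : I) :
  continuous (fun w : fiber_product => (val w).2 i).
Proof.
have c2 := @continuous_snd_proj i.
exact: (continuous_funcomp (@continuous_val _ fiber_product_set) c2).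
Qed.

Lemma fiber_product_continuous (T : topologicalType) (f : T -> fiber_product) :
  continuous (fun t => (val (f t)).1) ->
  (forall i, continuous (fun t => (val (f t)).2 i)) -> continuous f.
Proof.
move=> c1 c2; apply: continuous_to_set_type => t.
have c2' : (fun t => (val (f t)).2) @ t --> (val (f t)).2.
  apply/cvg_sup => i U [_ [[O oO <-] /= Oi OU]].
  apply: (filterS OU); apply: (c2 i t); exact: open_nbhs_nbhs.
have E : val \o f = (fun s => ((val (f s)).1, (val (f s)).2)).
  by apply: funext => s; exact: surjective_pairing.
by rewrite E; exact: cvg_pair (c1 t) c2'.
Qed.

Hypothesis pic : forall i, continuous (@pi i).
Hypothesis hZ : hausdorff_space Z.

Lemma fiber_product_hausdorff :
  (forall i, hausdorff_space (X i)) -> hausdorff_space fiber_product.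
Proof.
move=> hX; suff hP : hausdorff_space (Z * prod_topology X)%type.
  exact: (@continuous_inj_hausdorff fiber_product _ val val_inj
    (@continuous_val _ fiber_product_set) hP).
apply/hausdorff_closed_cover => -[z x] [z' x'] zx.
have [zz|zz] := pselect (z = z').
  have [i xi] : exists i, x i <> x' i.
    apply: contrapT => /forallNP xx; apply: zx; congr (_, _) => //.
    by apply/functional_extensionality_dep => i; apply: contrapT => /xx.
  have [A [B [cA cB Ax Bx AB]]] := (hausdorff_closed_cover _).1 (hX i) _ _ xi.
  have c2 := @continuous_snd_proj i.
  exists ((fun zx => zx.2 i) @^-1` A), ((fun zx => zx.2 i) @^-1` B).
  split=> //; try by move/continuous_closedP: c2; apply.
  by rewrite -preimage_setU AB.
have [A [B [cA cB Ax Bx AB]]] := (hausdorff_closed_cover _).1 hZ _ _ zz.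
have c1 := @continuous_fst Z (prod_topology X).
exists (fst @^-1` A), (fst @^-1` B).
split=> //; try by move/continuous_closedP: c1; apply.
by rewrite -preimage_setU AB.
Qed.

(** An intersection of equalizers of continuous maps into a Hausdorff space. *)
Lemma fiber_product_set_closed : closed fiber_product_set.
Proof.
have -> : fiber_product_set =
    \bigcap_i [set zx : Z * prod_topology X | pi (zx.2 i) = zx.1].
  by apply/seteqP; split=> [w ww i _|w ww i]; [exact: ww|exact: ww].
apply: closed_bigI => i _.
have c2 := @continuous_snd_proj i.
have c3 := continuous_funcomp c2 (@pic i).
have c1 := @continuous_fst Z (prod_topology X).
move=> w cw; apply: contrapT => ww.
have [A [B [cA cB Ax Bx AB]]] := (hausdorff_closed_cover _).1 hZ _ _ ww.
have nA : nbhs w ((fun zx => pi (zx.2 i)) @^-1` (~` A)).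
  by apply: c3; apply: open_nbhs_nbhs; split=> //; exact: closed_openC.
have nB : nbhs w (fst @^-1` (~` B)).
  by apply: c1; apply: open_nbhs_nbhs; split=> //; exact: closed_openC.
have [w' [/= ww' [nAw nBw]]] := cw _ (filterI nA nB).
have : (A `|` B) (w'.1) by rewrite AB.
by case=> // Aw'; apply: nAw; rewrite /= ww'.
Qed.

Lemma fiber_product_compact : compact [set: Z] ->
  (forall i, compact [set: X i]) -> compact [set: fiber_product].
Proof.
move=> cZ cX.
apply: closed_set_type_compact; last exact: fiber_product_set_closed.
rewrite -setXTT; apply: compact_setX => //.
have := @tychonoff {classic I} X (fun i => setT) cX.
by congr (@compact (prod_topology X) _); apply/seteqP; split.
Qed.

End FiberProduct.

(** * The spaces at the parabolic points and the topology of the blowup *)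

Section BlowupTopology.
Variables (G : groupType) (Y : topologicalType).
Variables (d : admissible (discrete_topology G) Y) (phi : action G Y).
Hypothesis GY : EPers (glue_inl d) (glue_action d phi).
Variable P' : set Y.
Hypothesis P'parabolic : P' `<=` parabolic_points d phi.
Variable C : P' -> topologicalType.
Variable dC : forall p : P',
  admissible (discrete_topology (Stab_at d phi (val p))) (C p).
Variable eta : forall p : P', action (Stab_at d phi (val p)) (C p).
Hypothesis SC : forall p : P',
  EPers (glue_inl (dC p)) (glue_action (dC p) (eta p)).
Variable h : forall p : P', act_orbit phi (val p) -> G.
Hypothesis hE : forall (p : P') (q : act_orbit phi (val p)),
  phi (h q) (val p) = val q.
Variable K : forall (p : P') (q : act_orbit phi (val p)),
  set (punctured (glue_inr d (val q))).
Hypothesis KE : forall (p : P') (q : act_orbit phi (val p)),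
  cocompact_by (stab_action (glue_action d phi) (glue_inr d (val q))) (@K p q).

Local Notation Z := (gluing d).
Local Notation Phi := (glue_action d phi).
Local Notation blowup := (blowup dC hE K).

Section Point.
Variables (p : P') (q : act_orbit phi (val p)).

Local Notation W := (gluing (dq dC hE q)).
Local Notation X := (blowup_at dC hE K q).

Lemma dq_compact : compact [set: W].
Proof.
apply: (closed_bij_compact (glue_conj_bij dC hE q) (glue_conj_closed hE q)).
exact: ep_compact (SC p).
Qed.

Lemma dq_hausdorff : hausdorff_space W.
Proof.
apply: (closed_bij_hausdorff (glue_conj_bij dC hE q) (glue_conj_closed hE q)).
exact: ep_hausdorff (SC p).
Qed.

Lemma conj_hM (x y : Stab_at d phi (val q)) :
  conj_h hE (x * y) = conj_h hE x * conj_h hE y.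
Proof. by apply: val_inj; rewrite /= !mulgA mulgK. Qed.

(** Since [conj_h] is multiplicative, it carries right translations to right translations. *)
Lemma dq_perspective : perspective (dq dC hE q).
Proof.
move=> f A c dA.
have pd : perspective (dC p) by exact: EPers_perspective (SC p).
apply: (pd (conj_h hE f)).
apply: (@adm_sub _ _ (dC p)) dA => _ [a Aaf <-].
by exists (a * f) => //; exact: conj_hM.
Qed.

Lemma punctured_lc (v : punctured (glue_inr d (val q))) :
  exists2 N : set (punctured (glue_inr d (val q))),
  nbhs v N & compact N.
Proof.
exact: punctured_locally_compact (ep_compact GY) (ep_hausdorff GY) v.
Qed.

Lemma punctured_T2 : hausdorff_space (punctured (glue_inr d (val q))).
Proof. exact: punctured_hausdorff (ep_hausdorff GY). Qed.

Lemma stab_action_continuous x :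
  continuous (stab_action Phi (glue_inr d (val q)) x).
Proof. exact/act_punctured_continuous/(ep_continuous GY). Qed.

Lemma stab_properly_discontinuous :
  properly_discontinuous (stab_action Phi (glue_inr d (val q))).
Proof.
have [pd _] := P'parabolic (set_valP p).
apply: properly_discontinuous_stab pd; first exact: ep_continuous GY.
by congr inr; exact: hE.
Qed.

Lemma blowup_at_hausdorff : hausdorff_space X.
Proof.
exact: (Pi_hausdorff dq_hausdorff dq_perspective punctured_T2 punctured_lc
  stab_action_continuous stab_properly_discontinuous (KE q)).
Qed.

Lemma blowup_at_compact : compact [set: X].
Proof.
exact: (Pi_compact dq_compact dq_perspective
  stab_action_continuous stab_properly_discontinuous (KE q)).
Qed.

(** A closed set through [q] pulls back to one containing all of [C p]; a closed set missing [q] is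
    compact in the punctured space, hence closed in [X]. *)
Lemma blowup_proj_continuous :
  continuous (@blowup_proj _ _ _ _ _ _ dC h hE K p q).
Proof.
apply/continuous_closedP => B cB.
have cBV : closed (val @^-1` B : set (punctured (glue_inr d (val q)))).
  move/continuous_closedP: (@continuous_val Z (~` [set glue_inr d (val q)])).
  exact.
have [Bq|Bq] := pselect (B (glue_inr d (val q))).
  apply/glue_closedP; split; [exact: cBV| |by []].
  by rewrite (_ : inr @^-1` _ = setT); [exact: closedT|apply/seteqP; split].
have cK : compact (val @^-1` B : set (punctured (glue_inr d (val q)))).
  apply: compact_set_type.
  rewrite (_ : _ @` _ = B); first exact: subclosed_compact cB (ep_compact GY) _.
  apply/seteqP; split=> [_ [v Bv <-]//|x Bx].
  have xq : x <> glue_inr d (val q) by move=> xq; apply: Bq; rewrite -xq.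
  by exists (to_punctured xq).
have := compact_glue_closed dq_hausdorff punctured_T2
  stab_properly_discontinuous (KE q) cK.
congr closed; apply/seteqP; split=> [_ [v Bv <-]//|[v|c]//].
by exists v.
Qed.

End Point.

(** Continuity of [s] on the gluing, read off on the boundary: the closed set [B] below pulls back
    to one containing [A]. *)
Lemma adm_eta (p : P') (s : Stab_at d phi (val p))
    (A : set (discrete_topology (Stab_at d phi (val p)))) (c : C p) :
  dC p A c -> dC p [set s * a | a in A] (eta p s c).
Proof.
move=> dA.
pose B : set (gluing (dC p)) := fun w => match w with
  | inl x => [set s * a | a in A] x
  | inr e => dC p [set s * a | a in A] e end.
have cB : closed B.
  apply/glue_closedP; split=> //; first exact: discrete_closed.
  by apply: adm_closed; exact: discrete_closed.
have /continuous_closedP/(_ _ cB) := ep_continuous (SC p) (h := s).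
move=> /glue_closedP[_ _]; apply; apply: adm_sub dA => a Aa.
by exists a.
Qed.

Lemma eta_continuous (p : P') (s : Stab_at d phi (val p)) :
  continuous (eta p s).
Proof.
apply/continuous_closedP => B cB.
have cB' : closed (glue_inr (dC p) @` B).
  apply/glue_closedP; split.
  - exact: discrete_closed.
  - by congr closed: cB; apply/seteqP; split=> [c Bc|c [e Be [<-]]//]; exists c.
  - rewrite (_ : inl @^-1` _ = set0) ?adm0//.
    by apply/seteqP; split=> // x [].
have /continuous_closedP/(_ _ cB') := ep_continuous (SC p) (h := s).
move=> /glue_closedP[_ + _]; congr closed.
apply/seteqP; split=> [c [e Be [ec]]|c Bc]; last by exists (eta p s c).
by rewrite /= -ec.
Qed.

(** Let [s] be [conj_stab hE gq]. Applying [eta p s] to a boundary point multiplies stabilizer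
    elements by [s] on the left, whereas [g] conjugates them. The discrepancy is right translation
    by [s^-1], absorbed by perspectivity. *)
Lemma blowup_trans_continuous (p : P') (q q' : act_orbit phi (val p)) (g : G)
    (gq : Phi g (glue_inr d (val q)) = glue_inr d (val q')) :
  continuous (@blowup_trans _ _ _ _ _ _ dC eta h hE K p q q' g gq).
Proof.
apply/continuous_closedP => B /glue_closedP[cV cC sB].
apply/glue_closedP; split.
- have /continuous_closedP/(_ _ cV) :=
    act_punctured_continuous (gx := gq) (ep_continuous GY (h:=g)).
  exact.
- have /continuous_closedP/(_ _ cC) := @eta_continuous p (conj_stab hE gq).
  exact.
move=> c /= /(adm_eta (conj_stab hE gq)) dc; apply: sB.
(* The image under [g] of the compact set at [q] replaces the one chosen at [q']. *)
have cN : compact (act_punctured gq @` (@K p q)).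
  apply: continuous_compact; last by case: (KE q).
  exact/continuous_subspaceT/act_punctured_continuous/(ep_continuous GY).
apply: (hits_compact (@dq_perspective p q') (@stab_properly_discontinuous p q')
  (KE q') cN).
have pd : perspective (dC p) by exact: EPers_perspective (SC p).
apply: (pd (conj_stab hE gq)^-1).
apply: adm_sub dc => _ [_ [x [_ [[v Kv <-] Bv]] <-] <-].
have gxq :
    Phi (g * stab_val x * g^-1) (glue_inr d (val q')) == glue_inr d (val q').
  by rewrite -{1}gq -actM mulgVK actM (eqP (stab_fix x)) gq.
exists (Stab gxq).
  exists (act_punctured gq (stab_action Phi _ x v)); split=> //.
  exists (act_punctured gq v); first by exists v.
  by apply: val_inj; rewrite /= -!glue_actM mulgVK.
apply: val_inj => /=.
by rewrite !invgM !invgK !mulgA !mulgK.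
Qed.

Local Notation base := (fun w : blowup => (val w).1).
Local Notation emb := (blowup_emb dC hE K).
Local Notation coord i := (fun w : blowup => (val w).2 i).

(** With this family and its projections, [blowup] is an instance of the general fiber product. *)
Let component (i : orbit_index phi P') : topologicalType :=
  blowup_at dC hE K (projT2 i).
Let component_proj (i : orbit_index phi P') : component i -> Z :=
  @blowup_proj _ _ _ _ _ _ dC h hE K _ (projT2 i).

Lemma blowup_base_continuous : continuous base.
Proof.
exact: (@fiber_product_base_continuous Z _ component component_proj).
Qed.

Lemma blowup_coord_continuous (i : orbit_index phi P') : continuous (coord i).
Proof.
exact: (@fiber_product_coord_continuous Z _ component component_proj i).
Qed.

Lemma blowup_hausdorff : hausdorff_space blowup.
Proof.
exact: (@fiber_product_hausdorff Z _ component component_proj (ep_hausdorff GY)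
  (fun i => @blowup_at_hausdorff _ (projT2 i))).
Qed.

Lemma blowup_compact : compact [set: blowup].
Proof.
exact: (@fiber_product_compact Z _ component component_proj
  (fun i => @blowup_proj_continuous _ (projT2 i))
  (ep_hausdorff GY) (ep_compact GY) (fun i => @blowup_at_compact _ (projT2 i))).
Qed.

Lemma blowup_act_continuous (g : G) :
  continuous (blowup_act eta g : blowup -> blowup).
Proof.
apply: (@fiber_product_continuous Z _ component component_proj).
  exact: (continuous_funcomp blowup_base_continuous
    (ep_continuous GY (h := g))).
move=> [p q]; pose j : orbit_index phi P' := existT _ p (orbit_move g^-1 q).
have cj : continuous (coord j) := @blowup_coord_continuous j.
have ct := @blowup_trans_continuous p _ q g (orbit_moveK d g q).
exact: (continuous_funcomp cj ct).
Qed.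

Lemma blowup_proj_inj (p : P') (q : act_orbit phi (val p))
    (x x' : blowup_at dC hE K q) : blowup_proj x <> glue_inr d (val q) ->
  blowup_proj x = blowup_proj x' -> x = x'.
Proof.
case: x x' => [v|c] [v'|c'] /= vq vv; [|by case: (vq vv)|by case: vq..].
by congr inl; exact: val_inj.
Qed.

(** An element of [G] differs from every [q], so by [blowup_proj_inj] a point lying over it has all
    its coordinates determined. The image is thus the preimage of an open set of [Z]. *)
Lemma blowup_emb_open (A : set G) : open (emb @` A).
Proof.
rewrite (_ : _ @` A = base @^-1` (glue_inl d @` A)).
  by move/continuousP: blowup_base_continuous; apply; exact: (ep_open GY).
apply/seteqP; split=> [_ [g Ag <-]|w [g Ag gw]]; first by exists g.
exists g => //; apply: val_inj => /=; rewrite [RHS]surjective_pairing -gw.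
congr (_, _); apply/functional_extensionality_dep => i.
apply: blowup_proj_inj => //; rewrite (set_valP w i).
exact: gw.
Qed.

(** * Limits of right translates and the smallness condition *)

Section Coordinate.
Variables (p : P') (q : act_orbit phi (val p)).

Local Notation W := (gluing (dq dC hE q)).
Local Notation X := (blowup_at dC hE K q).
Local Notation pt g := (to_punctured (@inl_neq G Y d g (val q))).

(** The point [c] is the limit of the stabilizer parts [s g], found before [f] is given. *)
Lemma blowup_coord_cvg (F : set_system G) : UltraFilter F ->
  glue_inl d @ F --> glue_inr d (val q) ->
  exists c, forall f : G,
    (fun g => glue_inl _ (pt (g * f)) : X) @ F --> (inr c : X).
Proof.
move=> FU Fq.
pose K0 := @K p q; have [cK _] := KE q.
have hZ := ep_hausdorff GY; have cZ := ep_compact GY.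
have pZ := EPers_perspective GY.
have [s sK] := choice (fun g => cocompact_cover (KE q) (pt g)).
have valK (A : set (punctured (glue_inr d (val q)))) : compact A ->
    compact (val @` A) /\ closed (val @` A).
  move=> cA; suff cA' : compact (val @` A).
    by split => //; exact: compact_closed.
  by apply: continuous_compact => //; exact/continuous_subspaceT/continuous_val.
have [[x|c] _ sw] := compact_ultra_cvg (f := glue_inl (dq dC hE q) \o s)
  (@dq_compact p q) FU filterT.
  (* If [s g] were eventually [x], then [g] would stay in the translate of [K0] by [x], which is
     closed in [Z] and misses [q]. *)
  move/glue_inl_cvg: sw => sx.
  have cxK : compact (stab_action Phi _ x @` K0).
    apply: continuous_compact => //.
    exact/continuous_subspaceT/stab_action_continuous.
  have [_ cl] := valK _ cxK.
  have [v _ vq] : (val @` (stab_action Phi _ x @` K0)) (glue_inr d (val q)).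
    apply: contrapT => nq; move/cvg_closedP: Fq => /(_ _ cl nq) Fn.
    have [g [/= sg]] := filter_ex (filterI sx Fn); apply.
    by exists (pt g) => //; rewrite -sg; exact: sK.
  by case: (punctured_neq vq).
exists c => f.
pose k g := (stab_val (s g))^-1 * g.
have kK g : (val @` K0) (glue_inl d (k g)).
  have [v Kv vg] := sK g; exists v => //.
  have := congr1 (fun u => Phi (stab_val (s g))^-1 (val u)) vg.
  by rewrite /= -glue_actM mulVg glue_act1.
have [cvK clK] := valK _ cK.
have [z Kz kz] := compact_ultra_cvg (f := glue_inl d \o k) cvK FU (nearW _ kK).
(* Either [k g] is eventually constant and [k g * f] has a limit in [G], or [k g] tends to a
   boundary point [e] in [K0], a limit that right translation by [f] preserves. Neither limit is
   [q]. *)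
have [z' zq' kz'] : exists2 z', z' <> glue_inr d (val q) &
    (glue_inl d \o (fun g => k g * f)) @ F --> z'.
  case: z Kz kz => [g _ /glue_inl_cvg kg|e [v _ ve] ke].
    exists (glue_inl d (g * f)) => //; apply/glue_inl_cvg.
    by apply: filterS kg => g' ->.
  exists (glue_inr d e); last exact: perspective_cvg.
  by move=> eq; apply: (@punctured_neq _ _ v); rewrite ve.
(* A compact neighbourhood of [z'] away from [q] eventually contains [k g * f], as [Pi_cvg_inr]
   requires. *)
have [N Nz cN] := punctured_lc (to_punctured zq').
have Nk : \forall g \near F, N (pt (k g * f)).
  case: Nz => _ [[O oO <-] Oz ON].
  have /kz' FO : nbhs z' O by exact: open_nbhs_nbhs.
  apply: (@filterS _ F _ ((glue_inl d \o (fun g => k g * f)) @^-1` O)) FO.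
  by move=> g Og; exact: ON.
apply: (Pi_cvg_inr (@dq_perspective p q) (@stab_properly_discontinuous p q)
  (KE q) _ cN _ sw).
apply: filterS Nk => g Ng; exists (pt (k g * f)) => //.
by apply: val_inj; rewrite /= /k !mulgA mulgV mul1g.
Qed.

End Coordinate.

(** Both translates have the same limit [y] in [Z]. It determines the coordinates at all [q] other
    than [y]; the coordinate at [y] comes from [blowup_coord_cvg]. *)
Lemma blowup_emb_cvg_eq (F : set_system G) (f f' : G) (w w' : blowup) :
  UltraFilter F -> (forall g, F (~` [set g])) ->
  (fun g => emb (g * f)) @ F --> w ->
  (fun g => emb (g * f')) @ F --> w' -> w = w'.
Proof.
move=> FU Fg fw fw'; have hZ := ep_hausdorff GY.
have pZ : perspective d by exact: EPers_perspective GY.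
have [[g|y] _ Fy] :=
  compact_ultra_cvg (f := glue_inl d) (ep_compact GY) FU filterT.
  (* An ultrafilter leaving every singleton cannot converge to a point of [G]. *)
  have /filter_ex[g' []//] : F ([set g] `&` ~` [set g]).
  by apply: filterI => //; exact: ((glue_inl_cvg d id g _).1 Fy).
have Fb k (v : blowup) : (fun g => emb (g * k)) @ F --> v ->
    (val v).1 = inr y.
  move=> Fv; apply: (cvg_unique hZ (F := glue_inl d \o (fun g => g * k) @ F)).
    exact: (cvg_comp _ _ Fv (@blowup_base_continuous v)).
  exact: (@perspective_cvg _ _ d G F id k y _ pZ Fy).
have b1 := Fb _ _ fw; have b2 := Fb _ _ fw'.
apply: val_inj; rewrite [LHS]surjective_pairing [RHS]surjective_pairing b1 b2.
congr (_, _); apply/functional_extensionality_dep => -[p q].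
have [yq|yq] := pselect (y = val q); last first.
  apply: blowup_proj_inj; rewrite (set_valP w (existT _ p q)) b1; first by case.
  by rewrite (set_valP w' (existT _ p q)) b2.
rewrite yq in Fy; have [c Fc] := blowup_coord_cvg FU Fy.
have Fi k (v : blowup) : (fun g => emb (g * k)) @ F --> v ->
    (val v).2 (existT _ p q) = inr c.
  move=> Fv; apply: (cvg_unique (@blowup_at_hausdorff p q) _ (Fc k)).
  exact: (cvg_comp _ _ Fv (@blowup_coord_continuous (existT _ p q) v)).
by rewrite (Fi _ _ fw) (Fi _ _ fw').
Qed.

(** Otherwise some ultrafilter on the exceptional set leaves every singleton. Both translates then
    tend to the same [w], so they are [u]-close through [w]. *)
Lemma blowup_emb_near (E : set_system (blowup * blowup)) u (f f' : G) :
  compatible_uniformity E -> E u ->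
  finite_set [set g | ~ u (emb (g * f), emb (g * f'))].
Proof.
move=> cE Eu; apply: contrapT => /infinite_ultra[F [FU Fu Fg]].
have [w _ fw] := compact_ultra_cvg (f := fun g => emb (g * f))
  blowup_compact FU filterT.
have [w' _ fw'] := compact_ultra_cvg (f := fun g => emb (g * f'))
  blowup_compact FU filterT.
have ww' := blowup_emb_cvg_eq FU Fg fw fw'; rewrite -{}ww' in fw'.
have [v Ev vu] := cu_split cE Eu.
have nv : nbhs w (xsection v w) by rewrite (cu_nbhs cE); exists v.
have nv' : nbhs w (xsection (v^-1)%relation w).
  by rewrite (cu_nbhs cE); exists (v^-1)%relation => //; exact: cu_inv Ev.
have Fv' : F ((fun g => emb (g * f)) @^-1` xsection (v^-1)%relation w).
  exact: fw.
have Fv : F ((fun g => emb (g * f')) @^-1` xsection v w).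
  exact: fw'.
have [g [[/xsectionP gv' /xsectionP gv] nug]] :=
  filter_ex (filterI (filterI Fv' Fv) Fu).
by apply: nug; apply: vu; exists w.
Qed.

Lemma blowup_EPers : EPers (emb) (blowup_action dC eta hE K).
Proof.
split.
- exact: blowup_compact.
- exact: blowup_hausdorff.
- by move=> g g' /(congr1 (fun w : blowup => (val w).1))[].
- exact: blowup_emb_open.
- exact: blowup_act_continuous.
- move=> g k; apply: val_inj => /=; congr (_, _).
  apply/functional_extensionality_dep => i; congr inl; exact: val_inj.
- move=> u F [E [cE Eu]] fF.
  (* Failure of smallness is witnessed by one of finitely many pairs [f], [f'] in [F]. *)
  pose bad f f' := [set g | ~ u (emb (g * f), emb (g * f'))].
  have fbad : finite_set (\bigcup_(f in F) \bigcup_(f' in F) bad f f').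
    apply: bigcup_finite => // f _; apply: bigcup_finite => // f' _.
    exact: blowup_emb_near cE Eu.
  apply: sub_finite_set fbad => g; apply: contra_notP => nbad.
  move=> [_ _] [/= [_ [f Ff <-] <-] [_ [f' Ff' <-] <-]].
  by apply: contrapT => nu; apply: nbad; exists f => //; exists f'.
Qed.

End BlowupTopology.

Theorem proposition2p16
  (* G +_d Y in EPers(G), with action L + phi *)
  (G : groupType) (Y : topologicalType)
  (d : admissible (discrete_topology G) Y) (phi : action G Y)
  (GY : EPers (glue_inl d) (glue_action d phi))
  (* representatives of the orbits of bounded parabolic points *)
  (P' : set Y)
  (P'rep : orbit_representatives phi (parabolic_points d phi) P')
  (* the family Stab p +_{d_p} C_p in EPers(Stab p), with actions L_p + eta_p *)
  (C : P' -> topologicalType)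
  (dC : forall p : P',
    admissible (discrete_topology (Stab_at d phi (val p))) (C p))
  (eta : forall p : P', action (Stab_at d phi (val p)) (C p))
  (SC : forall p : P',
    EPers (glue_inl (dC p)) (glue_action (dC p) (eta p)))
  (* the choices made in the construction of the blowup *)
  (h : forall p : P', act_orbit phi (val p) -> G)
  (hE : forall (p : P') (q : act_orbit phi (val p)), phi (h p q) (val p) = val q)
  (h1 : forall (p : P') (q : act_orbit phi (val p)), val q = val p -> h p q = 1)
  (K : forall (p : P') (q : act_orbit phi (val p)),
    set (punctured (glue_inr d (val q))))
  (KE : forall (p : P') (q : act_orbit phi (val p)),
    cocompact_by (stab_action (glue_action d phi) (glue_inr d (val q)))
      (K p q)) :
  EPers (blowup_emb dC hE K) (blowup_action dC eta hE K).
Proof.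
exact: (@blowup_EPers _ _ _ _ GY _ (proj1 P'rep) _ _ _ SC _ _ _ KE).
Qed.
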